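(* Let $K$ be a field of characteristic different from $2$, let $(V,q)$ be a nondegenerate quadratic space over $K$, and let $C_0=C_0(V,q)$ be its even Clifford algebra, with unity element $1_{C_0}$. There exists an even Clifford map $j:V\times V\to C_0$ which satisfies the following conditions: (a) as a $K$-algebra, $C_0$ is generated by $1_{C_0}$ and $\{j(x,y) : x,y\in V\}$; (b) for every $K$-algebra $A$ with unity element and every even Clifford map $\psi:V\times V\to A$, there exists a unique $K$-algebra homomorphism $\Psi:C_0\to A$ such that $\psi=\Psi\circ j$.
   Context: A quadratic space $(V,q)$ over $K$ is a finite dimensional $K$-vector space $V$ with a quadratic form $q:V\to K$; its bilinear form is $b_q(x,y)=\frac12(q(x+y)-q(x)-q(y))$. The Clifford algebra $C(V,q)$ is the quotient of the tensor algebra $T(V)$ by the ideal generated by all $x\otimes x-q(x)\cdot 1$ ($x\in V$), with canonical injection $i_q:V\to C(V,q)$. The even Clifford algebra $C_0(V,q)$ is the subalgebra of $C(V,q)$ fixed by the automorphism $\gamma$ with $\gamma(i_q(x))=-i_q(x)$ for all $x\in V$, i.e. the subalgebra spanned by products of an even number of vectors. Algebra homomorphisms preserve unity elements. Given a $K$-algebra $A$ with unity element $1_A$, an even Clifford map is a $K$-bilinear map $\psi:V\times V\to A$ such that for all $x,y,z\in V$: (1) $\psi(x,y)\psi(y,z)=q(y)\cdot\psi(x,z)$, and (2) $\psi(x,x)=q(x)\cdot 1_A$. *)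

(* Defs.v *)
From HB Require Import structures.
From mathcomp Require Import all_boot all_order all_algebra.
From mathcomp Require Import boolp.
From mathcomp Require Import finmap monalg.

Set Implicit Arguments.
Unset Strict Implicit.
Unset Printing Implicit Defensive.

Import GRing.Theory.
Local Open Scope ring_scope.
Local Open Scope quotient_scope.

(* Unital associative K-algebras, as rings A with a central structure map
   K -> A; k in K acts on A by multiplication by [kmap A k].  Unlike with
   [algType K], the zero algebra is allowed.  (MathComp's hierarchy does not
   admit a join of [pzRingType] and [lmodType].) *)
Record kalg (K : pzRingType) := Kalg {
  kring :> pzRingType;
  kmap : {rmorphism K -> kring};
  kmap_central : forall k (x : kring), kmap k * x = x * kmap k
}.
Arguments kmap {K} A : rename.

Lemma in_alg_central (K : pzRingType) (A : algType K) (k : K) (x : A) :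
  in_alg A k * x = x * in_alg A k.
Proof. by rewrite /= mulr_algl mulr_algr. Qed.

Definition kalg_of_alg (K : pzRingType) (A : algType K) : kalg K :=
  Kalg (@in_alg_central K A).

Definition alg_hom (K : pzRingType) (A B : kalg K) (f : A -> B) : Prop :=
  [/\ zmod_morphism f, monoid_morphism f & forall k, f (kmap A k) = kmap B k].

Definition kbilinear (K : fieldType) (V : lmodType K) (A : kalg K)
    (psi : V -> V -> A) : Prop :=
  bilinear_for (kmap A \; *%R) (kmap A \; *%R) psi.

(* The unit is not required to belong to S, so that it has to be listed among
   the generators in [generated_by]. *)
Definition subalgebra (K : pzRingType) (A : kalg K) (S : A -> Prop) : Prop :=
  [/\ S 0,
      forall x y, S x -> S y -> S (x + y),
      forall k x, S x -> S (kmap A k * x)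
    & forall x y, S x -> S y -> S (x * y)].

Definition generated_by (K : pzRingType) (A : kalg K) (G : A -> Prop) : Prop :=
  forall S : A -> Prop, subalgebra S -> (forall x, G x -> S x) ->
  forall x, S x.

Section AlgHomTheory.
Variables (K : pzRingType) (A B : kalg K) (f : A -> B).
Hypothesis hom_f : alg_hom f.

Lemma alg_homB x y : f (x - y) = f x - f y.
Proof. by case: hom_f => fB _ _; apply: fB. Qed.
Lemma alg_hom0 : f 0 = 0.
Proof. by rewrite -(subrr 0) alg_homB subrr. Qed.
Lemma alg_homN x : f (- x) = - f x.
Proof. by rewrite -sub0r alg_homB alg_hom0 sub0r. Qed.
Lemma alg_homD x y : f (x + y) = f x + f y.
Proof. by rewrite -[in LHS](opprK y) alg_homB alg_homN opprK. Qed.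
Lemma alg_hom1 : f 1 = 1.
Proof. by case: hom_f => _ [f1 _] _. Qed.
Lemma alg_homM x y : f (x * y) = f x * f y.
Proof. by case: hom_f => _ [_ fM] _; apply: fM. Qed.
Lemma alg_homK k : f (kmap A k) = kmap B k.
Proof. by case: hom_f. Qed.

End AlgHomTheory.

Section QuotientAlgebra.
Variables (K : pzRingType) (A : kalg K) (G : A -> Prop).

Inductive ideal_gen : A -> Prop :=
| ideal_gen_base x : G x -> ideal_gen x
| ideal_gen0 : ideal_gen 0
| ideal_genD x y : ideal_gen x -> ideal_gen y -> ideal_gen (x + y)
| ideal_genMl a x : ideal_gen x -> ideal_gen (a * x)
| ideal_genMr a x : ideal_gen x -> ideal_gen (x * a).

Lemma ideal_genN x : ideal_gen x -> ideal_gen (- x).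
Proof. by move=> Ix; rewrite -mulN1r; apply: ideal_genMl. Qed.

Definition ideal_eq : rel A := fun x y => `[< ideal_gen (x - y) >].

Lemma ideal_eq_equiv : equiv_class_of ideal_eq.
Proof.
split=> [x|x y|y x z].
- by apply/asboolP; rewrite subrr; apply: ideal_gen0.
- by apply/asboolP/asboolP => /ideal_genN; rewrite opprB.
- move=> /asboolP Ixy /asboolP Iyz; apply/asboolP.
  by rewrite -(subrKA y); apply: ideal_genD.
Qed.

Canonical ideal_equiv := EquivRelPack ideal_eq_equiv.

Definition quot_ring := {eq_quot ideal_eq}.
HB.instance Definition _ := Choice.on quot_ring.
HB.instance Definition _ := EqQuotient.on quot_ring.

Definition qpi (x : A) : quot_ring := \pi_quot_ring x.

Lemma qpiP (x y : A) : qpi x = qpi y <-> ideal_gen (x - y).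
Proof. by split=> [/eqquotP /asboolP //|Ixy]; apply/eqquotP/asboolP. Qed.

Lemma qpi_repr (u : quot_ring) : qpi (repr u) = u.
Proof. exact: reprK. Qed.

Lemma qpi_surj (u : quot_ring) : exists x, u = qpi x.
Proof. by exists (repr u); rewrite qpi_repr. Qed.

Definition qopp (u : quot_ring) : quot_ring := qpi (- repr u).
Definition qadd (u v : quot_ring) : quot_ring := qpi (repr u + repr v).
Definition qmul (u v : quot_ring) : quot_ring := qpi (repr u * repr v).

Lemma ideal_repr (x : A) : ideal_gen (repr (qpi x) - x).
Proof. by apply/qpiP; rewrite qpi_repr. Qed.

Lemma qoppE x : qopp (qpi x) = qpi (- x).
Proof. by apply/qpiP; rewrite -opprD; apply/ideal_genN/ideal_repr. Qed.

Lemma qaddE x y : qadd (qpi x) (qpi y) = qpi (x + y).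
Proof.
by apply/qpiP; rewrite opprD addrACA; apply: ideal_genD; apply: ideal_repr.
Qed.

Lemma qmulE x y : qmul (qpi x) (qpi y) = qpi (x * y).
Proof.
apply/qpiP; set a := repr _; set b := repr _.
have -> : a * b - x * y = (a - x) * b + x * (b - y).
  by rewrite mulrBl mulrBr addrA subrK.
by apply: ideal_genD; [apply: ideal_genMr | apply: ideal_genMl];
  apply: ideal_repr.
Qed.

Let quotE := (qoppE, qaddE, qmulE).

Fact qaddA : associative qadd.
Proof.
move=> u v w; have [[x ->] [y ->]] := (qpi_surj u, qpi_surj v).
by have [z ->] := qpi_surj w; rewrite !quotE addrA.
Qed.
Fact qaddC : commutative qadd.
Proof.
move=> u v; have [[x ->] [y ->]] := (qpi_surj u, qpi_surj v).
by rewrite !quotE addrC.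
Qed.
Fact qadd0 : left_id (qpi 0) qadd.
Proof. by move=> u; have [x ->] := qpi_surj u; rewrite !quotE add0r. Qed.
Fact qaddN : left_inverse (qpi 0) qopp qadd.
Proof. by move=> u; have [x ->] := qpi_surj u; rewrite !quotE addNr. Qed.

HB.instance Definition _ :=
  GRing.isZmodule.Build quot_ring qaddA qaddC qadd0 qaddN.

Fact qmulA : associative qmul.
Proof.
move=> u v w; have [[x ->] [y ->]] := (qpi_surj u, qpi_surj v).
by have [z ->] := qpi_surj w; rewrite !quotE mulrA.
Qed.
Fact qmul1 : left_id (qpi 1) qmul.
Proof. by move=> u; have [x ->] := qpi_surj u; rewrite !quotE mul1r. Qed.
Fact qmulr1 : right_id (qpi 1) qmul.
Proof. by move=> u; have [x ->] := qpi_surj u; rewrite !quotE mulr1. Qed.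
Fact qmulDl : left_distributive qmul qadd.
Proof.
move=> u v w; have [[x ->] [y ->]] := (qpi_surj u, qpi_surj v).
by have [z ->] := qpi_surj w; rewrite !quotE mulrDl.
Qed.
Fact qmulDr : right_distributive qmul qadd.
Proof.
move=> u v w; have [[x ->] [y ->]] := (qpi_surj u, qpi_surj v).
by have [z ->] := qpi_surj w; rewrite !quotE mulrDr.
Qed.

HB.instance Definition _ :=
  GRing.Zmodule_isPzRing.Build quot_ring qmulA qmul1 qmulr1 qmulDl qmulDr.

Fact qpi_is_zmod_morphism : zmod_morphism qpi.
Proof. by move=> x y; rewrite -qaddE -qoppE. Qed.
Fact qpi_is_monoid_morphism : monoid_morphism qpi.
Proof. by split=> // x y; rewrite -qmulE. Qed.
HB.instance Definition _ :=
  GRing.isZmodMorphism.Build A quot_ring qpi qpi_is_zmod_morphism.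
HB.instance Definition _ :=
  GRing.isMonoidMorphism.Build A quot_ring qpi qpi_is_monoid_morphism.

Fact qmap_central k (u : quot_ring) :
  (qpi \o kmap A) k * u = u * (qpi \o kmap A) k.
Proof.
by have [x ->] := qpi_surj u; rewrite /= -!rmorphM kmap_central.
Qed.

Definition quot_alg : kalg K := Kalg qmap_central.

Definition qproj (x : A) : quot_alg := qpi x.

Lemma qproj_alg_hom : alg_hom qproj.
Proof.
by split=> //; [exact: qpi_is_zmod_morphism | exact: qpi_is_monoid_morphism].
Qed.

Lemma qproj_surj (u : quot_alg) : exists x, u = qproj x.
Proof. exact: qpi_surj. Qed.

Lemma qproj_eq x y : G (x - y) -> qproj x = qproj y.
Proof. by move=> Gxy; apply/qpiP; apply: ideal_gen_base. Qed.

Section Lift.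
Variables (B : kalg K) (f : A -> B).

Definition quot_lift (u : quot_alg) : B := f (repr (u : quot_ring)).

Hypothesis (hom_f : alg_hom f) (f0 : forall x, G x -> f x = 0).

Lemma quot_lift_qproj x : quot_lift (qproj x) = f x.
Proof.
have I0 y : ideal_gen y -> f y = 0.
  elim=> {y}[y /f0 //||y z _ Iy _ Iz|a y _ Iy|a y _ Iy].
  - exact: alg_hom0.
  - by rewrite alg_homD // Iy Iz addr0.
  - by rewrite alg_homM // Iy mulr0.
  - by rewrite alg_homM // Iy mul0r.
rewrite /quot_lift; apply/eqP; rewrite -subr_eq0 -(alg_homB hom_f).
by rewrite I0 //; apply: ideal_repr.
Qed.

Lemma quot_lift_alg_hom : alg_hom quot_lift.
Proof.
split.
- move=> u v; have [[x ->] [y ->]] := (qproj_surj u, qproj_surj v).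
  by rewrite -(alg_homB qproj_alg_hom) !quot_lift_qproj alg_homB.
- split; first by rewrite -(alg_hom1 qproj_alg_hom) quot_lift_qproj alg_hom1.
  move=> u v; have [[x ->] [y ->]] := (qproj_surj u, qproj_surj v).
  by rewrite -(alg_homM qproj_alg_hom) !quot_lift_qproj alg_homM.
- by move=> k; rewrite -(alg_homK qproj_alg_hom) quot_lift_qproj alg_homK.
Qed.

End Lift.

Lemma quot_alg_hom_ext (B : kalg K) (f g : quot_alg -> B) :
  (forall x, f (qproj x) = g (qproj x)) -> f =1 g.
Proof. by move=> fg u; have [x ->] := qproj_surj u. Qed.

End QuotientAlgebra.

Section FreeAlgebra.
Variables (K : fieldType) (V : choiceType).
Implicit Types (g : {malg K[{fmonom V}]}) (w : {fmonom V}).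

Fact malgC_central k g : malgC k * g = g * malgC k.
Proof.
rewrite malgM_def fgmulUg malgM_def fgmulgU.
by apply: eq_bigr => w _; rewrite mul1m mulm1 mulrC.
Qed.

(* The free associative algebra on the set V. *)
Definition free_alg : kalg K :=
  Kalg (malgC_central : forall k (x : {malg K[{fmonom V}]}), _).

Definition free_inj (v : V) : free_alg := mkmalgU (fmu v) 1.

Section Lift.
Variables (B : kalg K) (f : V -> B).

Definition free_lift (g : free_alg) : B :=
  \sum_(w <- msupp g) kmap B (mcoeff w g) * \prod_(v <- fmonom_val w) f v.

Lemma free_liftEw (d : {fset {fmonom V}}%fset) g : (msupp g `<=` d)%fset ->
  free_lift g = \sum_(w <- d) kmap B (mcoeff w g) * \prod_(v <- fmonom_val w) f v.
Proof.
move=> le; rewrite [LHS](big_fset_incl _ le) => //= w _ /mcoeff_outdom ->.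
by rewrite rmorph0 mul0r.
Qed.

Lemma free_liftU k w :
  free_lift (mkmalgU w k) = kmap B k * \prod_(v <- fmonom_val w) f v.
Proof. by rewrite (free_liftEw msuppU_le) big_seq_fset1 mcoeffUU. Qed.

Fact free_lift_is_zmod_morphism : zmod_morphism free_lift.
Proof.
move=> g1 g2; pose d := (msupp g1 `|` msupp g2 `|` msupp (g1 - g2)%R)%fset.
have [le1 le2] : (msupp g1 `<=` d)%fset /\ (msupp g2 `<=` d)%fset.
  by split; apply/fsubsetP => w; rewrite !inE => ->; rewrite ?orbT.
have le3 : (msupp (g1 - g2)%R `<=` d)%fset.
  by apply/fsubsetP => w; rewrite !inE => ->; rewrite ?orbT.
rewrite (free_liftEw le1) (free_liftEw le2) (free_liftEw le3) -sumrB.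
by apply: eq_bigr => w _; rewrite mcoeffB rmorphB mulrBl.
Qed.
HB.instance Definition _ := GRing.isZmodMorphism.Build
  {malg K[{fmonom V}]} B free_lift free_lift_is_zmod_morphism.

Lemma free_lift_inj v : free_lift (free_inj v) = f v.
Proof. by rewrite free_liftU rmorph1 mul1r fmU big_seq1. Qed.

Lemma free_lift_alg_hom : alg_hom free_lift.
Proof.
have fK k : free_lift (malgC k) = kmap B k.
  by rewrite free_liftU fm1 big_nil mulr1.
split=> //; first exact: free_lift_is_zmod_morphism.
split=> [|g1 g2]; first by rewrite -mpolyC1E fK rmorph1.
rewrite [g1 * g2]malgME !raddf_sum mulr_suml /=; apply: eq_bigr => w1 _.
rewrite raddf_sum mulr_sumr /=; apply: eq_bigr => w2 _.
rewrite free_liftU fmM big_cat rmorphM /=.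
by rewrite -!mulrA; congr (_ * _); rewrite !mulrA kmap_central.
Qed.

End Lift.

Lemma free_alg_hom_ext (B : kalg K) (f g : free_alg -> B) :
  alg_hom f -> alg_hom g -> (forall v, f (free_inj v) = g (free_inj v)) ->
  f =1 g.
Proof.
move=> hf hg fg x; rewrite [x](@monalgE {fmonom V} K).
elim/big_rec: _ => [|w y _ IH]; first by rewrite !alg_hom0.
rewrite (alg_homD hf) (alg_homD hg) IH; congr (_ + _).
have -> : mkmalgU w (mcoeff w x) =
    kmap free_alg (mcoeff w x) * \prod_(v <- fmonom_val w) free_inj v.
  have -> : \prod_(v <- fmonom_val w) free_inj v = mkmalgU w 1.
    case: w => s /=; elim: s => [|v s IHs].
      by rewrite big_nil -fmoneE.
    rewrite big_cons IHs [LHS](@fgmulUU _ K) mulr1; congr mkmalgU.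
    by apply/eqP; rewrite fmP fmM fmU.
  by rewrite [RHS](@fgmulUU _ K) mulr1 mul1m.
rewrite !alg_homM // !alg_homK //; congr (_ * _).
elim: (fmonom_val w) => [|v s IHs]; first by rewrite !big_nil !alg_hom1.
by rewrite !big_cons !alg_homM // fg IHs.
Qed.

End FreeAlgebra.

Lemma alg_hom_comp (K : pzRingType) (A B C : kalg K) (g : B -> C)
    (f : A -> B) :
  alg_hom g -> alg_hom f -> alg_hom (g \o f).
Proof.
move=> hg hf; split=> [x y||k] /=; first by rewrite !alg_homB.
  by split=> [|x y] /=; rewrite ?alg_hom1 ?alg_homM.
by rewrite !alg_homK.
Qed.

Section Linearity.
Variables (K : fieldType) (V : lmodType K) (F : kalg K) (g : V -> F).

Inductive linear_rel : F -> Prop :=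
| linear_relD x y : linear_rel (g (x + y) - (g x + g y))
| linear_relZ k x : linear_rel (g (k *: x) - kmap F k * g x).

Lemma qproj_linear :
  linear_for (kmap (quot_alg linear_rel) \; *%R) (qproj linear_rel \o g).
Proof.
have hp := qproj_alg_hom linear_rel.
move=> k x y; rewrite [LHS]/= [RHS]/(_ * _ + _).
rewrite (qproj_eq (linear_relD _ _)) (alg_homD hp).
by rewrite (qproj_eq (linear_relZ _ _)) (alg_homM hp) (alg_homK hp).
Qed.

Lemma linear_rel0 (B : kalg K) (f : F -> B) :
    alg_hom f -> linear_for (kmap B \; *%R) (f \o g) ->
  forall x, linear_rel x -> f x = 0.
Proof.
move=> hf lin.
have fD y z : f (g (y + z)) = f (g y) + f (g z).
  by have := lin 1 y z; rewrite /= scale1r rmorph1 mul1r.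
have f0 : f (g 0) = 0 by apply: (addrI (f (g 0))); rewrite -fD !addr0.
move=> _ [y z|k y]; rewrite (alg_homB hf).
  by rewrite (alg_homD hf) fD subrr.
rewrite (alg_homM hf) (alg_homK hf).
by have := lin k y 0; rewrite /= addr0 f0 addr0 => ->; rewrite subrr.
Qed.

End Linearity.

Section TensorAlgebra.
Variables (K : fieldType) (V : lmodType K).

(* T(V) is the free algebra on the set V modulo the linearity of V -> T(V). *)
Definition tensor_alg : kalg K := quot_alg (linear_rel (@free_inj K V)).

Definition tensor_inj (x : V) : tensor_alg :=
  qproj (linear_rel (@free_inj K V)) (free_inj K x).

Lemma tensor_inj_linear : linear_for (kmap tensor_alg \; *%R) tensor_inj.
Proof. exact: qproj_linear. Qed.

Section Lift.
Variables (B : kalg K) (f : V -> B).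

Definition tensor_lift : tensor_alg -> B := quot_lift (free_lift f).

Hypothesis lin_f : linear_for (kmap B \; *%R) f.

Let rel0 x : linear_rel (@free_inj K V) x -> free_lift f x = 0.
Proof.
apply: linear_rel0; first exact: free_lift_alg_hom.
have fE v : (free_lift f \o @free_inj K V) v = f v by exact: free_lift_inj.
by move=> k y z; rewrite !fE lin_f.
Qed.

Lemma tensor_lift_alg_hom : alg_hom tensor_lift.
Proof. exact: quot_lift_alg_hom (free_lift_alg_hom f) rel0. Qed.

Lemma tensor_lift_inj x : tensor_lift (tensor_inj x) = f x.
Proof.
transitivity (free_lift f (free_inj K x)); last exact: free_lift_inj.
exact: quot_lift_qproj (free_lift_alg_hom f) rel0 _.
Qed.

End Lift.

Lemma tensor_alg_hom_ext (B : kalg K) (f g : tensor_alg -> B) :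
  alg_hom f -> alg_hom g -> (forall x, f (tensor_inj x) = g (tensor_inj x)) ->
  f =1 g.
Proof.
move=> hf hg fg; apply: quot_alg_hom_ext.
have hp := qproj_alg_hom (linear_rel (@free_inj K V)).
exact: free_alg_hom_ext (alg_hom_comp hf hp) (alg_hom_comp hg hp) fg.
Qed.

End TensorAlgebra.

Section QuadraticForm.
Variables (K : fieldType) (V : lmodType K) (q : V -> K).

Definition polar (x y : V) : K := 2%:R^-1 * (q (x + y) - q x - q y).

Definition quadratic_form : Prop :=
  (forall k x, q (k *: x) = k ^+ 2 * q x) /\ bilinear_for *%R *%R polar.

Definition quadratic_nondegenerate : Prop :=
  forall x, (forall y, polar x y = 0) -> x = 0.

End QuadraticForm.

Section SquareRelation.
Variables (K : fieldType) (V : lmodType K) (q : V -> K).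
Variables (T : kalg K) (t : V -> T).

Inductive square_rel : T -> Prop :=
| Square_rel x : square_rel (t x * t x - kmap T (q x)).

Lemma qproj_square x :
  qproj square_rel (t x) * qproj square_rel (t x) =
  kmap (quot_alg square_rel) (q x).
Proof.
have hp := qproj_alg_hom square_rel.
by rewrite -(alg_homM hp) (qproj_eq (Square_rel _)) (alg_homK hp).
Qed.

Lemma alg_hom_linear (B : kalg K) (f : T -> B) :
  alg_hom f -> linear_for (kmap T \; *%R) t ->
  linear_for (kmap B \; *%R) (f \o t).
Proof.
move=> hf lin k x y; rewrite [LHS]/= lin [LHS]/= (alg_homD hf) (alg_homM hf).
by rewrite (alg_homK hf).
Qed.

Lemma square_rel0 (B : kalg K) (f : T -> B) :
    alg_hom f -> (forall x, f (t x) * f (t x) = kmap B (q x)) ->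
  forall x, square_rel x -> f x = 0.
Proof.
move=> hf fq _ [x].
by rewrite (alg_homB hf) (alg_homM hf) (alg_homK hf) fq subrr.
Qed.

End SquareRelation.

Section FixedSubalgebra.
Variables (K : pzRingType) (A : kalg K) (s : A -> A) (hom_s : alg_hom s).

Definition fixed_pred : {pred A} := fun x => s x == x.

Fact fixed_subring : subring_closed fixed_pred.
Proof.
split=> [|x y|x y]; rewrite !unfold_in.
- by rewrite (alg_hom1 hom_s).
- by move=> /eqP sx /eqP sy; rewrite (alg_homB hom_s) sx sy.
- by move=> /eqP sx /eqP sy; rewrite (alg_homM hom_s) sx sy.
Qed.

Record fixed_ring :=
  FixedElt { fixed_val : A; fixed_valP : fixed_val \in fixed_pred }.
HB.instance Definition _ := [isSub for fixed_val].
HB.instance Definition _ := [Choice of fixed_ring by <:].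
HB.instance Definition _ := GRing.SubChoice_isSubPzRing.Build
  A fixed_pred fixed_ring fixed_subring.

Fact kmap_fixed k : kmap A k \in fixed_pred.
Proof. by rewrite unfold_in (alg_homK hom_s). Qed.

Definition fixed_kmap (k : K) : fixed_ring := FixedElt (kmap_fixed k).

Fact fixed_kmap_is_zmod_morphism : zmod_morphism fixed_kmap.
Proof. by move=> k l; apply: val_inj; rewrite /= rmorphB. Qed.
Fact fixed_kmap_is_monoid_morphism : monoid_morphism fixed_kmap.
Proof.
by split=> [|k l]; apply: val_inj; rewrite /= ?rmorph1 ?rmorphM.
Qed.
HB.instance Definition _ := GRing.isZmodMorphism.Build
  K fixed_ring fixed_kmap fixed_kmap_is_zmod_morphism.
HB.instance Definition _ := GRing.isMonoidMorphism.Build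
  K fixed_ring fixed_kmap fixed_kmap_is_monoid_morphism.

Fact fixed_kmap_central k (u : fixed_ring) :
  fixed_kmap k * u = u * fixed_kmap k.
Proof. by apply: val_inj; rewrite /= kmap_central. Qed.

Definition fixed_alg : kalg K := Kalg fixed_kmap_central.

Definition fixed_incl (u : fixed_alg) : A := fixed_val u.

Lemma fixed_incl_alg_hom : alg_hom fixed_incl.
Proof. by []. Qed.

Lemma fixed_incl_inj : injective fixed_incl.
Proof. exact: val_inj. Qed.

Lemma fixed_inclP x : s x = x <-> exists u, x = fixed_incl u.
Proof.
split=> [/eqP sx|[u ->]]; first by exists (FixedElt sx).
by apply/eqP; case: u.
Qed.

End FixedSubalgebra.

Section CliffordAlgebra.
Variables (K : fieldType) (V : lmodType K) (q : V -> K).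

Definition clifford : kalg K := quot_alg (square_rel q (@tensor_inj K V)).

Definition clifford_inj (x : V) : clifford :=
  qproj (square_rel q (@tensor_inj K V)) (tensor_inj x).

Lemma clifford_inj_linear : linear_for (kmap clifford \; *%R) clifford_inj.
Proof.
exact: alg_hom_linear (qproj_alg_hom _) (@tensor_inj_linear K V).
Qed.

Lemma clifford_inj_sqr x :
  clifford_inj x * clifford_inj x = kmap clifford (q x).
Proof. exact: qproj_square. Qed.

Section Lift.
Variables (B : kalg K) (f : V -> B).

Definition clifford_lift : clifford -> B := quot_lift (tensor_lift f).

Hypothesis lin_f : linear_for (kmap B \; *%R) f.
Hypothesis sqr_f : forall x, f x * f x = kmap B (q x).

Let rel0 x : square_rel q (@tensor_inj K V) x -> tensor_lift f x = 0.
Proof.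
apply: square_rel0; first exact: tensor_lift_alg_hom.
by move=> y; rewrite !tensor_lift_inj.
Qed.

Lemma clifford_lift_alg_hom : alg_hom clifford_lift.
Proof. exact: quot_lift_alg_hom (tensor_lift_alg_hom lin_f) rel0. Qed.

Lemma clifford_lift_inj x : clifford_lift (clifford_inj x) = f x.
Proof.
transitivity (tensor_lift f (tensor_inj x)); last exact: tensor_lift_inj.
exact: quot_lift_qproj (tensor_lift_alg_hom lin_f) rel0 _.
Qed.

End Lift.

Lemma clifford_hom_ext (B : kalg K) (f g : clifford -> B) :
  alg_hom f -> alg_hom g ->
  (forall x, f (clifford_inj x) = g (clifford_inj x)) -> f =1 g.
Proof.
move=> hf hg fg; apply: quot_alg_hom_ext.
have hp := qproj_alg_hom (square_rel q (@tensor_inj K V)).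
exact: tensor_alg_hom_ext (alg_hom_comp hf hp) (alg_hom_comp hg hp) fg.
Qed.

(* By [gamma_alg_hom], [gamma_inj] and [clifford_hom_ext], the unique algebra
   endomorphism that extends x |-> - x. *)
Definition gamma : clifford -> clifford :=
  clifford_lift (fun x => - clifford_inj x).

Let gamma_lin : linear_for (kmap clifford \; *%R) (fun x => - clifford_inj x).
Proof. by move=> k x y; rewrite clifford_inj_linear opprD /= mulrN. Qed.

Let gamma_sqr x : - clifford_inj x * - clifford_inj x = kmap clifford (q x).
Proof. by rewrite mulrNN clifford_inj_sqr. Qed.

Lemma gamma_alg_hom : alg_hom gamma.
Proof. exact: clifford_lift_alg_hom. Qed.

Lemma gamma_inj x : gamma (clifford_inj x) = - clifford_inj x.
Proof. exact: clifford_lift_inj. Qed.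

Lemma gammaK : involutive gamma.
Proof.
apply: clifford_hom_ext; first exact: alg_hom_comp gamma_alg_hom gamma_alg_hom.
  by split.
by move=> x /=; rewrite gamma_inj (alg_homN gamma_alg_hom) gamma_inj opprK.
Qed.

Definition even_clifford : kalg K := fixed_alg gamma_alg_hom.

End CliffordAlgebra.

Definition even_clifford_map (K : fieldType) (V : lmodType K) (q : V -> K)
    (A : kalg K) (psi : V -> V -> A) : Prop :=
  [/\ kbilinear psi,
      forall x y z, psi x y * psi y z = kmap A (q y) * psi x z
    & forall x, psi x x = kmap A (q x)].

(* Main.v *)
(* For a vector e with q e != 0, an even Clifford map psi yields the linear map
     x |-> [[0, psi x e], [(q e)^-1 psi e x, 0]],   V -> M_2(A),
   whose squares are q x.  It extends to the whole Clifford algebra, and on the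
   even part it is diagonal, with upper left entry the required Psi.  If q = 0,
   then V = 0 and Psi is the restriction of the extension of 0 : V -> A. *)

From HB Require Import structures.
Require Import Defs.
From mathcomp Require Import all_boot all_order all_algebra.
From mathcomp Require Import boolp.
From mathcomp Require monalg.

Set Implicit Arguments.
Unset Strict Implicit.
Unset Printing Implicit Defensive.

Import GRing.Theory.
Local Open Scope ring_scope.

(** The equalizer of [f] and [g] is a subalgebra. This gives the uniqueness of [Psi]. *)
Lemma alg_hom_generated_eq (K : pzRingType) (A B : kalg K) (G : A -> Prop)
    (f g : A -> B) :
  alg_hom f -> alg_hom g -> generated_by G -> (forall x, G x -> f x = g x) ->
  f =1 g.
Proof.
move=> hf hg genG fg x; apply: (genG (fun x => f x = g x)) => // {x}; split.
- by rewrite !alg_hom0.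
- by move=> x y fx fy; rewrite (alg_homD hf) (alg_homD hg) fx fy.
- move=> k x fx; rewrite (alg_homM hf) (alg_homM hg) fx.
  by rewrite (alg_homK hf) (alg_homK hg).
- by move=> x y fx fy; rewrite (alg_homM hf) (alg_homM hg) fx fy.
Qed.

(** * Matrix algebras over a possibly noncommutative [K]-algebra *)

Section MatrixAlgebra.
Variables (K : pzRingType) (A : kalg K) (n : nat).

Fact scalar_kmap_is_zmod_morphism :
  zmod_morphism (fun k => (kmap A k)%:M : 'M[A]_n).
Proof. by move=> k l; rewrite !rmorphB. Qed.
Fact scalar_kmap_is_monoid_morphism :
  monoid_morphism (fun k => (kmap A k)%:M : 'M[A]_n).
Proof. by split=> [|k l]; rewrite ?rmorph1 // rmorphM scalar_mxM. Qed.

Definition scalar_kmap (k : K) : 'M[A]_n := (kmap A k)%:M.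
HB.instance Definition _ := GRing.isZmodMorphism.Build
  K 'M[A]_n scalar_kmap scalar_kmap_is_zmod_morphism.
HB.instance Definition _ := GRing.isMonoidMorphism.Build
  K 'M[A]_n scalar_kmap scalar_kmap_is_monoid_morphism.

Lemma scalar_kmapE k (M : 'M[A]_n) i l :
  (scalar_kmap k * M) i l = kmap A k * M i l.
Proof. by rewrite -[_ * M]/(_ *m M) mul_scalar_mx mxE. Qed.

Fact scalar_kmap_central k (M : 'M[A]_n) :
  scalar_kmap k * M = M * scalar_kmap k.
Proof.
apply/matrixP=> i l; rewrite scalar_kmapE kmap_central -[M * _]/(M *m _) mxE.
rewrite (bigD1 l) //= big1 => [|m /negPf ml]; rewrite mxE ?ml ?mulr0 //.
by rewrite eqxx mulr1n addr0.
Qed.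

Definition matrix_alg : kalg K := Kalg scalar_kmap_central.

End MatrixAlgebra.

Lemma mulmx2E (A : pzRingType) (M N : 'M[A]_2) r c :
  (M * N) r c = M r 0 * N 0 c + M r 1 * N 1 c.
Proof.
rewrite -[M * N]/(M *m N) mxE big_ord_recl big_ord1.
by congr (_ + M r _ * N _ c); apply: val_inj.
Qed.

(** In [f x * f y * (f y * f z)] the two middle factors collapse to the central scalar [q y]. *)
Lemma mul_even_clifford_map (K : fieldType) (V : lmodType K) (q : V -> K)
    (B : kalg K) (f : V -> B) :
  linear_for (kmap B \; *%R) f -> (forall x, f x * f x = kmap B (q x)) ->
  even_clifford_map q (fun x y => f x * f y).
Proof.
move=> lin_f sqr_f; split=> //; first split.
- by move=> y k x z; rewrite lin_f mulrDl /= mulrA.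
- by move=> x k y z; rewrite lin_f mulrDr /= !mulrA -kmap_central.
- by move=> x y z; rewrite mulrA -(mulrA (f x)) sqr_f -kmap_central mulrA.
Qed.

(** * Generators of the even Clifford algebra *)

Section Clifford.
Variables (K : fieldType) (V : lmodType K) (q : V -> K).

Local Notation C := (clifford q).
Local Notation C0 := (even_clifford q).
Local Notation i := (@clifford_inj K V q).

(** Unfolding the right-hand side displays [g] as a finite sum of scalars times products of
    generators. *)
Lemma free_algE (g : free_alg K V) : g = free_lift (@free_inj K V) g.
Proof.
apply: (@free_alg_hom_ext _ _ _ id) => [|| v]; first by [].
  exact: free_lift_alg_hom.
by rewrite free_lift_inj.
Qed.

(** Lifting [z] through both quotients to the free algebra makes it a linear combination of words in
    vectors, and each word is built from [1] by left multiplications. *)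
Lemma clifford_ind (P : C -> Prop) :
  P 0 -> P 1 -> (forall z w, P z -> P w -> P (z + w)) ->
  (forall k z, P z -> P (kmap C k * z)) -> (forall x z, P z -> P (i x * z)) ->
  forall z, P z.
Proof.
move=> P0 P1 PD PK Pi z; have [t ->] := qproj_surj z.
have [g ->] := qproj_surj t.
pose f := qproj (square_rel q (@tensor_inj K V))
          \o qproj (linear_rel (@free_inj K V)).
have hf : alg_hom f by apply: alg_hom_comp; apply: qproj_alg_hom.
rewrite -[qproj _ _]/(f g) (free_algE g).
apply: (big_ind (fun g => P (f g))) => [|g1 g2 Pg1 Pg2|w _].
- by rewrite (alg_hom0 hf).
- by rewrite (alg_homD hf); apply: PD.
rewrite (alg_homM hf) (alg_homK hf); apply: PK.
elim: (monalg.fmonom_val w) => [|x s IHs].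
  by rewrite big_nil (alg_hom1 hf).
by rewrite big_cons (alg_homM hf); apply: Pi.
Qed.

Fact clifford_inj2_fixed x y : i x * i y \in fixed_pred (@gamma K V q).
Proof.
by rewrite unfold_in (alg_homM (gamma_alg_hom q)) !gamma_inj mulrNN.
Qed.

Definition even_inj (x y : V) : C0 := FixedElt (clifford_inj2_fixed x y).

Lemma even_inj_even_clifford_map : even_clifford_map q even_inj.
Proof.
have [[linl linr] jM jq] :=
  mul_even_clifford_map (@clifford_inj_linear K V q) (@clifford_inj_sqr K V q).
split; first split.
- by move=> y k x z; apply: val_inj; apply: linl.
- by move=> x k y z; apply: val_inj; apply: linr.
- by move=> x y z; apply: val_inj; apply: jM.
- by move=> x; apply: val_inj; apply: jq.
Qed.

(** Every element of [C] is a sum of an element of [S] and an odd one. If the sum is fixed by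
    [gamma], its odd part equals its own opposite, hence vanishes because 2 is invertible. *)
Lemma even_clifford_generated : 2%N \notin [pchar K] ->
  generated_by (fun z : C0 => z = 1 \/ exists x y, z = even_inj x y).
Proof.
move=> char_not2 S [S0 SD SK SM] SG.
have hg := gamma_alg_hom q.
have fixC0 (v : C0) : gamma (fixed_incl v) = fixed_incl v.
  by apply/(fixed_inclP hg); exists v.
(* The odd part is described through left products by vectors, so that the sum
   of S and the odd part is visibly stable under left multiplication by V. *)
pose odd o := gamma o = - o /\
  forall x, exists2 e : C0, S e & i x * o = fixed_incl e.
have decomp z : exists e : C0, exists o, [/\ S e, odd o & z = fixed_incl e + o].
  elim/clifford_ind: z.
  - exists 0, 0; split=> //; last by rewrite addr0.
    split; first by rewrite (alg_hom0 hg) oppr0.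
    by move=> x; exists 0; rewrite ?mulr0.
  - exists 1, 0; split; [by apply: SG; left| |by rewrite addr0].
    split; first by rewrite (alg_hom0 hg) oppr0.
    by move=> x; exists 0; rewrite ?mulr0.
  - move=> z w [e1 [o1 [Se1 [go1 io1] ->]]] [e2 [o2 [Se2 [go2 io2] ->]]].
    exists (e1 + e2), (o1 + o2); split; [exact: SD| |by rewrite addrACA].
    split; first by rewrite (alg_homD hg) go1 go2 opprD.
    move=> x; have [[f1 Sf1 o1E] [f2 Sf2 o2E]] := (io1 x, io2 x).
    by exists (f1 + f2); [exact: SD | rewrite mulrDr o1E o2E].
  - move=> k z [e [o [Se [go io] ->]]].
    exists (kmap C0 k * e), (kmap C k * o).
    split; [exact: SK| |by rewrite mulrDr].
    split; first by rewrite (alg_homM hg) (alg_homK hg) go mulrN.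
    move=> x; have [f Sf oE] := io x; exists (kmap C0 k * f); first exact: SK.
    by rewrite mulrA -kmap_central -mulrA oE.
  (* Left multiplication by a vector swaps the roles: [i x * o] is the new part in [S], and
     [i x * e] the new odd part, since [i y * (i x * e)] is [even_inj y x * e]. *)
  - move=> x z [e [o [Se [go io] ->]]]; have [f Sf oE] := io x.
    exists f, (i x * fixed_incl e).
    split; [exact: Sf| |by rewrite mulrDr oE addrC].
    split.
      rewrite (alg_homM hg) gamma_inj fixC0.
      exact: mulNr.
    move=> y; exists (even_inj y x * e); last by rewrite mulrA.
    by apply: SM => //; apply: SG; right; exists y, x.
move=> u; have [e [o [Se [go _] uE]]] := decomp (fixed_incl u).
suff o0 : o = 0 by rewrite o0 addr0 in uE; rewrite (fixed_incl_inj uE).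
have : gamma (fixed_incl u) = fixed_incl u by [].
rewrite {1 2}uE (alg_homD hg) go fixC0 => /addrI oN.
have two0 : 2%:R != 0 :> K by move: char_not2; rewrite inE.
have oo : 2%:R * o = 0 by rewrite mulr_natl mulr2n -[X in X + _]oN addNr.
rewrite -[o]mul1r -(rmorph1 (kmap C)) -(mulVf two0) rmorphM rmorph_nat -mulrA.
by rewrite oo mulr0.
Qed.

(** * Factoring an even Clifford map through the even Clifford algebra *)

Section Extension.
Variables (A : kalg K) (psi : V -> V -> A).
Hypothesis psi_even : even_clifford_map q psi.

Let psiDZl k x y z : psi (k *: x + y) z = kmap A k * psi x z + psi y z.
Proof. by case: psi_even => [[lin _] _ _]; apply: lin. Qed.
Let psiDZr k x y z : psi z (k *: x + y) = kmap A k * psi z x + psi z y.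
Proof. by case: psi_even => [[_ lin] _ _]; apply: lin. Qed.

Lemma even_clifford_map_lift_anisotropic e :
  generated_by (fun z : C0 => z = 1 \/ exists x y, z = even_inj x y) ->
  q e != 0 ->
  exists Psi : C0 -> A,
    alg_hom Psi /\ forall x y, psi x y = Psi (even_inj x y).
Proof.
case: (psi_even) => _ psiM psiq genC0 qe0.
(* The model is left multiplication by [x] on [C], a right [C0]-module with basis [1, e]: [x * e]
   lies in [C0], and [x = e * ((q e)^-1 * (e * x))]. Products of two vectors are replaced by values
   of [psi]. *)
pose f (x : V) : matrix_alg A 2 := \matrix_(r, c)
  if r == c then 0
  else if r == 0 then psi x e else kmap A (q e)^-1 * psi e x.
have lin_f : linear_for (kmap (matrix_alg A 2) \; *%R) f.
  move=> k x y; apply/matrixP=> r c.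
  rewrite mxE [RHS]mxE /= scalar_kmapE !mxE.
  case: ifP => _; first by rewrite mulr0 addr0.
  case: ifP => _; first by rewrite psiDZl.
  by rewrite psiDZr mulrDr !mulrA kmap_central.
have fM x y : f x * f y = \matrix_(r, c)
    if r == c then if r == 0 then psi x y
      else kmap A (q e)^-1 * (psi e x * psi y e) else 0.
  apply/matrixP=> r c; rewrite mulmx2E !mxE.
  case: r c => [[|[|//]] ?] [[|[|//]] ?] /=;
    rewrite ?mul0r ?mulr0 ?addr0 ?add0r //=; last by rewrite mulrA.
  (* Upper left entry: [psi x e * psi e y] is [q e] times [psi x y], and [(q e)^-1] cancels
     [q e]. *)
  rewrite mulrA -kmap_central -mulrA psiM mulrA -rmorphM mulVf //.
  by rewrite rmorph1 mul1r.
have sqr_f x : f x * f x = kmap (matrix_alg A 2) (q x).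
  rewrite fM; apply/matrixP=> r c; rewrite !mxE.
  case: eqP => _; last by rewrite mulr0n.
  rewrite mulr1n; case: ifP => _ //.
  (* Lower right entry: [psi e x * psi x e] is [q x] times [psi e e], that is [q x * q e]. *)
  by rewrite psiM psiq -!rmorphM mulrCA mulVf // mulr1.
have hF := clifford_lift_alg_hom lin_f sqr_f.
have Fi := clifford_lift_inj lin_f sqr_f.
set F := clifford_lift f in hF Fi.
pose F0 (u : C0) := F (fixed_incl u).
have hF0 : alg_hom F0 by apply: alg_hom_comp hF (fixed_incl_alg_hom _).
have F0j x y : F0 (even_inj x y) = f x * f y.
  by rewrite /F0 (alg_homM hF) !Fi.
(* The upper left entry of a product is [u00 * v00 + u01 * v10], so it is multiplicative on [C0]
   once [u01] vanishes there. The matrices with zero upper right entry form a subalgebra, so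
   generators suffice. *)
have F0_01 u : F0 u 0 1 = 0.
  apply: (genC0 (fun u => F0 u 0 1 = 0)) => {u}; first split.
  - by rewrite (alg_hom0 hF0) mxE.
  - by move=> u v Fu Fv; rewrite (alg_homD hF0) mxE Fu Fv addr0.
  - move=> k u Fu; rewrite (alg_homM hF0) (alg_homK hF0) scalar_kmapE Fu.
    exact: mulr0.
  - by move=> u v Fu Fv; rewrite (alg_homM hF0) mulmx2E Fu Fv mulr0 mul0r addr0.
  - by move=> _ [->|[x [y ->]]]; rewrite ?(alg_hom1 hF0) ?F0j ?fM mxE.
exists (fun u => F0 u 0 0); split; last by move=> x y; rewrite F0j fM mxE.
split.
- by move=> u v; rewrite (alg_homB hF0) !mxE.
- split=> [|u v]; first by rewrite (alg_hom1 hF0) mxE.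
  by rewrite (alg_homM hF0) mulmx2E F0_01 mul0r addr0.
- by move=> k; rewrite (alg_homK hF0) mxE.
Qed.

(** Here [psi] is zero, because its only value is [psi 0 0], the image of [q 0]. *)
Lemma even_clifford_map_lift_trivial :
  (forall x : V, x = 0) -> q 0 = 0 ->
  exists Psi : C0 -> A,
    alg_hom Psi /\ forall x y, psi x y = Psi (even_inj x y).
Proof.
move=> V0 q0.
have lin0 : linear_for (kmap A \; *%R) (fun _ : V => 0 : A).
  by move=> k x y; rewrite /= mulr0 addr0.
have sqr0 x : 0 * 0 = kmap A (q x) by rewrite (V0 x) q0 rmorph0 mul0r.
have hF := clifford_lift_alg_hom lin0 sqr0.
exists (clifford_lift (fun=> 0) \o @fixed_incl _ _ _ _); split.
  exact: alg_hom_comp hF (fixed_incl_alg_hom _).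
move=> x y /=; rewrite (alg_homM hF) !(clifford_lift_inj lin0 sqr0) mul0r.
case: psi_even => _ _ psiq.
by rewrite (V0 x) (V0 y) psiq q0 rmorph0.
Qed.

End Extension.

End Clifford.

Theorem theorem3p3 (K : fieldType) (V : vectType K) (q : V -> K)
    (char_not2 : 2%N \notin [pchar K])
    (quad_q : quadratic_form q) (nondeg_q : quadratic_nondegenerate q) :
  exists j : V -> V -> even_clifford q,
    [/\ even_clifford_map q j,
        generated_by (fun z : even_clifford q =>
          z = 1 \/ exists x y : V, z = j x y)
      & forall (A : kalg K) (psi : V -> V -> A), even_clifford_map q psi ->
          exists! Psi : even_clifford q -> A,
            alg_hom Psi /\ forall x y : V, psi x y = Psi (j x y)].
Proof.
have genC0 := @even_clifford_generated K V q char_not2.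
exists (@even_inj K V q); split=> //; first exact: even_inj_even_clifford_map.
move=> A psi psi_even.
have [Psi [hPsi PsiE]] : exists Psi : even_clifford q -> A,
    alg_hom Psi /\ forall x y, psi x y = Psi (even_inj q x y).
  have [[e qe0]|q0] := pselect (exists e, q e != 0).
    exact: even_clifford_map_lift_anisotropic qe0.
  have {}q0 x : q x = 0 by apply: contrapT => /eqP qx; apply: q0; exists x.
  apply: even_clifford_map_lift_trivial => // x.
  (* When [q] vanishes identically, so does its polar form, and every vector lies in the radical. *)
  by apply: nondeg_q => y; rewrite /polar !q0 !subr0 mulr0.
exists Psi; split=> // Phi [hPhi PhiE]; apply/funext.
apply: (alg_hom_generated_eq hPsi hPhi genC0) => _ [->|[x [y ->]]].
  by rewrite !alg_hom1.
by rewrite -PsiE PhiE.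
Qed.
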